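(* Assume the loss $f(\cdot,z)$ is convex and $\beta$-smooth for all $z\in\mathcal{Z}$. Consider full-batch GD with $T$ iterations and learning rates $\eta_t\le1/(2\beta)$ for all $t\le T+1$. Then for the outputs $W_{T+1}\equiv A(S)$, $W^{(i)}_{T+1}\equiv A(S^{(i)})$, $$\epsilon_{\mathrm{stab}(A)}\le\frac{4\,\epsilon_{\mathrm{path}}}{n^2}\sum_{t=1}^T\eta_t\le\frac{32\beta\sum_{t=1}^T\eta_t}{n^2}\left(\mathbb{E}[\|W_1-W^*_S\|_2^2]+\epsilon_{\mathbf{c}}\sum_{t=1}^T\eta_t\right).$$
   Context: Let $\mathcal{D}$ be a distribution on $\mathcal{Z}$ and $z_1,\dots,z_n,z_i'$ i.i.d. from $\mathcal{D}$; $S=(z_1,\dots,z_n)$, $S^{(i)}$ is $S$ with $z_i$ replaced by $z_i'$. The loss $f:\mathbb{R}^d\times\mathcal{Z}\to[0,\infty)$ is non-negative; $\beta$-smooth means $\|\nabla f(w,z)-\nabla f(u,z)\|_2\le\beta\|w-u\|_2$. $R_S(w)=\frac1n\sum_j f(w,z_j)$, $W^*_S$ a minimizer of $R_S$ (assumed to exist). Full-batch GD on $S$: from a fixed $W_1$, $W_{t+1}=W_t-\frac{\eta_t}{n}\sum_{j=1}^n\nabla f(W_t,z_j)$, $t=1,\dots,T$, output $A(S)=W_{T+1}$; $W^{(i)}_t$ are the GD iterates on $S^{(i)}$ from the same $W_1$ with the same step sizes. Definitions: $\epsilon_{\mathrm{stab}(A)}=\mathbb{E}[\|A(S)-A(S^{(i)})\|_2^2]$;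 $\epsilon_{\mathrm{path}}=\sum_{t=1}^T\eta_t\mathbb{E}[\|\nabla f(W_t,z_i)\|_2^2]$; $\epsilon_{\mathbf{c}}=\mathbb{E}[R_S(W^*_S)]$. *)

(* Defs.v *)
From HB Require Import structures.
From mathcomp Require Import all_boot all_order all_algebra.
From mathcomp Require Import all_classical all_reals all_analysis.
Import numFieldNormedType.Exports.
Import Order.TTheory GRing.Theory Num.Theory.

Set Implicit Arguments.
Unset Strict Implicit.
Unset Printing Implicit Defensive.

Local Open Scope classical_set_scope.
Local Open Scope ring_scope.

Definition dotv (R : realType) (d : nat) (u v : 'rV[R]_d) : R :=
  \sum_(j < d) u ord0 j * v ord0 j.

Definition sqnorm (R : realType) (d : nat) (v : 'rV[R]_d) : R := dotv v v.

Definition norm2 (R : realType) (d : nat) (v : 'rV[R]_d) : R := Num.sqrt (sqnorm v).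

Definition convex_fun (R : realType) (d : nat) (g : 'rV[R]_d -> R) : Prop :=
  forall (x y : 'rV[R]_d) (t : R), 0 <= t <= 1 ->
    g (t *: x + (1 - t) *: y) <= t * g x + (1 - t) * g y.

Definition is_gradient (R : realType) (d : nat) (g : 'rV[R]_d -> R)
    (G : 'rV[R]_d -> 'rV[R]_d) : Prop :=
  forall w : 'rV[R]_d, differentiable g w /\ forall v, 'd g w v = dotv (G w) v.

Definition smooth_grad (R : realType) (d : nat) (G : 'rV[R]_d -> 'rV[R]_d)
    (beta : R) : Prop :=
  forall w u : 'rV[R]_d, norm2 (G w - G u) <= beta * norm2 (w - u).

Definition emp_risk (R : realType) (d : nat) (Z : Type) (n : nat)
    (f : 'rV[R]_d -> Z -> R) (s : 'I_n -> Z) (w : 'rV[R]_d) : R :=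
  n%:R^-1 * \sum_(j < n) f w (s j).

(* full-batch GD: gd_iter ... k = W_{k+1}, with W_1 = W1 and
   W_{t+1} = W_t - (eta_t / n) sum_j grad f(W_t, z_j)  *)
Fixpoint gd_iter (R : realType) (d : nat) (Z : Type) (n : nat)
    (gradf : 'rV[R]_d -> Z -> 'rV[R]_d) (eta : nat -> R) (W1 : 'rV[R]_d)
    (s : 'I_n -> Z) (k : nat) : 'rV[R]_d :=
  match k with
  | 0 => W1
  | k'.+1 =>
      let w := gd_iter gradf eta W1 s k' in
      w - (eta k'.+1 / n%:R) *: \sum_(j < n) gradf w (s j)
  end.

(* W_t for t >= 1 *)
Definition gdW (R : realType) (d : nat) (Z : Type) (n : nat)
    (gradf : 'rV[R]_d -> Z -> 'rV[R]_d) (eta : nat -> R) (W1 : 'rV[R]_d)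
    (s : 'I_n -> Z) (t : nat) : 'rV[R]_d :=
  gd_iter gradf eta W1 s t.-1.

Definition replace_at (Z : Type) (n : nat) (s : 'I_n -> Z) (i : 'I_n) (z' : Z)
    : 'I_n -> Z :=
  fun j => if j == i then z' else s j.

Definition iid_law (R : realType) (dO dZ : measure_display)
    (O : measurableType dO) (P : probability O R)
    (Z : measurableType dZ) (D : probability Z R) (m : nat)
    (X : 'I_m -> O -> Z) : Prop :=
  (forall j, measurable_fun setT (X j)) /\
  forall A : 'I_m -> set Z, (forall j, measurable (A j)) ->
    P (\bigcap_(j in [set: 'I_m]) (X j @^-1` A j)) = (\prod_(j < m) D (A j))%E.

(* Main.v *)
(* Dropping the i-th example, the averaged loss is still convex and smooth, so
   a gradient step on it is nonexpansive; hence the distance between the two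
   trajectories grows at step t by at most eta_t / n times the sum of the two
   gradient norms at the differing example.  Squaring by Cauchy-Schwarz with
   weights eta_t and taking expectations gives the first bound, since swapping
   z_i and z_i' preserves the law of the sample.  For the second, the empirical
   risk and hence the iterates are symmetric in the examples, so the expected
   squared gradient at z_i is the average over all examples, which is at most
   4 beta R_S(W_t) by nonnegativity and smoothness, and the regret of gradient
   descent controls the weighted sum of the R_S(W_t).  Exchangeability needs the
   iterates to be measurable functions of the sample: a loss continuous in w and
   measurable in z is jointly measurable along measurable w, by rounding w to a
   grid. *)
Require Import Defs.
From HB Require Import structures.
From mathcomp Require Import all_boot all_order all_algebra.
From mathcomp Require Import all_classical all_reals all_analysis.
From mathcomp Require Import perm measurable_realfun ring lra.
Import numFieldNormedType.Exports.
Import Order.TTheory GRing.Theory Num.Theory.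

Set Implicit Arguments.
Unset Strict Implicit.

Local Open Scope classical_set_scope.
Local Open Scope ring_scope.

(** * Cauchy-Schwarz inequality and Euclidean geometry *)

(** Induction on the sequence. The statement is strengthened by nonnegativity of the two sums on the
    right, which the induction step uses. *)
Lemma weighted_cauchy_schwarz (R : realFieldType) (I : Type) (r : seq I)
    (Q : pred I) (w a b : I -> R) :
  (forall i, Q i -> 0 <= w i) ->
  (\sum_(i <- r | Q i) w i * (a i * b i)) ^+ 2 <=
    (\sum_(i <- r | Q i) w i * a i ^+ 2) * (\sum_(i <- r | Q i) w i * b i ^+ 2).
Proof.
move=> w0; suff : [/\ 0 <= \sum_(i <- r | Q i) w i * a i ^+ 2,
    0 <= \sum_(i <- r | Q i) w i * b i ^+ 2 &
    (\sum_(i <- r | Q i) w i * (a i * b i)) ^+ 2 <=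
    (\sum_(i <- r | Q i) w i * a i ^+ 2) * (\sum_(i <- r | Q i) w i * b i ^+ 2)].
  by case.
elim: r => [|i r IH]; first by rewrite !big_nil mulr0 expr0n.
rewrite !big_cons; case: ifPn => // /w0 wi; case: IH.
set A := \sum_(_ <- _ | _) _ => A0; set B := \sum_(_ <- _ | _) _ => B0.
set C := \sum_(_ <- _ | _) _ => CAB.
have s0 x y : 0 <= x -> 0 <= w i * y ^+ 2 + x.
  by move=> x0; rewrite addr_ge0// mulr_ge0// sqr_ge0.
split; [exact: s0|exact: s0|].
(* After expansion, adding the term [i] changes right side minus left side by [w i] times this
   expression. Multiplied by [A > 0] it is a square plus a multiple of [A * B - C ^+ 2]; if [A = 0]
   then [C = 0] as well. *)
have key : 0 <= A * b i ^+ 2 + B * a i ^+ 2 - 2 * C * (a i * b i).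
  have [A00|Ane] := eqVneq A 0.
    have C0 : C = 0.
      apply/eqP; rewrite -sqrf_eq0 eq_le sqr_ge0 andbT.
      by rewrite A00 mul0r in CAB.
    by rewrite A00 C0 !mul0r !mulr0 mul0r subr0 add0r mulr_ge0// sqr_ge0.
  have Ap : 0 < A by rewrite lt_neqAle eq_sym Ane.
  rewrite -(pmulr_rge0 _ Ap).
  have -> : A * (A * b i ^+ 2 + B * a i ^+ 2 - 2 * C * (a i * b i)) =
    (A * b i - C * a i) ^+ 2 + (A * B - C ^+ 2) * a i ^+ 2 by ring.
  by rewrite addr_ge0 ?sqr_ge0// mulr_ge0 ?sqr_ge0// subr_ge0.
have := mulr_ge0 wi key; nra.
Qed.

Section euclidean.
Variables (R : realType) (d : nat).
Implicit Types u v w : 'rV[R]_d.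

Lemma dotvC u v : dotv u v = dotv v u.
Proof. by apply: eq_bigr => j _; rewrite mulrC. Qed.

Lemma dotvDl u v w : dotv (u + v) w = dotv u w + dotv v w.
Proof. by rewrite -big_split/=; apply: eq_bigr => j _; rewrite !mxE mulrDl. Qed.

Lemma dotvZl a u w : dotv (a *: u) w = a * dotv u w.
Proof. by rewrite /dotv big_distrr/=; apply: eq_bigr => j _; rewrite !mxE mulrA. Qed.

Lemma dotvNl u w : dotv (- u) w = - dotv u w.
Proof. by rewrite -scaleN1r dotvZl mulN1r. Qed.

Lemma dotvDr u v w : dotv w (u + v) = dotv w u + dotv w v.
Proof. by rewrite !(dotvC w) dotvDl. Qed.

Lemma dotvZr a u w : dotv w (a *: u) = a * dotv w u.
Proof. by rewrite !(dotvC w) dotvZl. Qed.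

Lemma dotvNr u w : dotv w (- u) = - dotv w u.
Proof. by rewrite !(dotvC w) dotvNl. Qed.

Definition dotvE := (dotvDl, dotvDr, dotvZl, dotvZr, dotvNl, dotvNr).

Lemma dotv0l w : dotv 0 w = 0.
Proof. by rewrite -(scale0r 0) dotvZl mul0r. Qed.

Lemma dotv_suml (I : Type) (r : seq I) (Q : pred I) (F : I -> 'rV[R]_d) w :
  dotv (\sum_(i <- r | Q i) F i) w = \sum_(i <- r | Q i) dotv (F i) w.
Proof.
elim: r => [|i r IH]; first by rewrite !big_nil dotv0l.
by rewrite !big_cons; case: ifP => // _; rewrite dotvDl IH.
Qed.

Lemma sqnorm_ge0 u : 0 <= sqnorm u.
Proof. by apply: sumr_ge0 => j _; rewrite -expr2 sqr_ge0. Qed.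

Lemma sqnorm0 : sqnorm (0 : 'rV[R]_d) = 0.
Proof. exact: dotv0l. Qed.

Lemma sqnormN u : sqnorm (- u) = sqnorm u.
Proof. by rewrite /sqnorm dotvNl dotvNr opprK. Qed.

Lemma sqnormBC u v : sqnorm (u - v) = sqnorm (v - u).
Proof. by rewrite -opprB sqnormN. Qed.

Lemma sqnormZ a u : sqnorm (a *: u) = a ^+ 2 * sqnorm u.
Proof. by rewrite /sqnorm dotvZl dotvZr mulrA -expr2. Qed.

Lemma sqnormBZ a u v :
  sqnorm (u - a *: v) = sqnorm u - 2 * a * dotv v u + a ^+ 2 * sqnorm v.
Proof. by rewrite /sqnorm !dotvE (dotvC u v); ring. Qed.

Lemma sqr_norm2 u : norm2 u ^+ 2 = sqnorm u.
Proof. by rewrite sqr_sqrtr// sqnorm_ge0. Qed.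

Lemma norm2_ge0 u : 0 <= norm2 u.
Proof. exact: sqrtr_ge0. Qed.

Lemma norm2_le u v : (norm2 u <= norm2 v) = (sqnorm u <= sqnorm v).
Proof. by rewrite ler_sqrt// sqnorm_ge0. Qed.

Lemma cauchy_schwarz u v : dotv u v <= norm2 u * norm2 v.
Proof.
apply: le_trans (ler_norm _) _.
rewrite -(ler_pXn2r (_ : 0 < 2)%N)// ?nnegrE ?mulr_ge0 ?norm2_ge0//.
rewrite real_normK ?num_real// exprMn !sqr_norm2.
have := @weighted_cauchy_schwarz R _ (index_enum 'I_d) xpredT (fun=> 1)
  (u ord0) (v ord0) (fun _ _ => ler01).
under eq_bigr do rewrite mul1r.
under [X in _ <= X * _]eq_bigr do rewrite mul1r expr2.
by under [X in _ <= _ * X]eq_bigr do rewrite mul1r expr2.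
Qed.

Lemma norm2_triangle u v : norm2 (u + v) <= norm2 u + norm2 v.
Proof.
rewrite -(ler_pXn2r (_ : 0 < 2)%N)// ?nnegrE ?addr_ge0 ?norm2_ge0//.
rewrite sqrrD !sqr_norm2 {1}/sqnorm !dotvE (dotvC v u).
by have := cauchy_schwarz u v; rewrite /sqnorm; lra.
Qed.

Lemma norm2Z a u : 0 <= a -> norm2 (a *: u) = a * norm2 u.
Proof.
move=> a0; by rewrite /norm2 sqnormZ sqrtrM ?sqr_ge0// sqrtr_sqr ger0_norm.
Qed.

Lemma norm2N u : norm2 (- u) = norm2 u.
Proof. by rewrite /norm2 sqnormN. Qed.

Lemma norm2_0 : norm2 (0 : 'rV[R]_d) = 0.
Proof. by rewrite /norm2 sqnorm0 sqrtr0. Qed.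

Lemma norm2_sum (I : Type) (r : seq I) (Q : pred I) (F : I -> 'rV[R]_d) :
  norm2 (\sum_(i <- r | Q i) F i) <= \sum_(i <- r | Q i) norm2 (F i).
Proof.
elim: r => [|i r IH]; first by rewrite !big_nil norm2_0.
rewrite !big_cons; case: ifP => // _.
by apply: le_trans (norm2_triangle _ _) _; rewrite lerD2l.
Qed.

Lemma abs_coord_le_norm2 u j : `|u ord0 j| <= norm2 u.
Proof.
rewrite -(ler_pXn2r (_ : 0 < 2)%N)// ?nnegrE ?norm2_ge0//.
rewrite real_normK ?num_real// sqr_norm2 /sqnorm /dotv (bigD1 j)//= expr2.
by rewrite lerDl sumr_ge0// => k _; rewrite -expr2 sqr_ge0.
Qed.

(** The topology of ['rV[R]_d] comes from the maximum norm, while smoothness is stated in [norm2].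
    This comparison and the preceding one translate between them. *)
Lemma norm2_le_mx_norm u : norm2 u <= Num.sqrt d%:R * `|u|.
Proof.
rewrite -(ler_pXn2r (_ : 0 < 2)%N)// ?nnegrE ?mulr_ge0 ?norm2_ge0 ?sqrtr_ge0//.
rewrite sqr_norm2 exprMn sqr_sqrtr ?ler0n// /sqnorm /dotv.
have -> : d%:R * `|u| ^+ 2 = \sum_(j < d) `|u| ^+ 2.
  by rewrite sumr_const card_ord mulr_natl.
apply: ler_sum => j _; rewrite -expr2 -real_normK ?num_real//.
rewrite lerXn2r ?nnegrE// (_ : `|u| = mx_norm u)// mx_normrE.
by apply: (le_bigmax _ (fun ij : 'I_1 * 'I_d => `|u ij.1 ij.2|) (ord0, j)).
Qed.

End euclidean.

(** * Smooth convex functions and a single gradient step *)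

(** First-order form of convexity: the tangent hyperplanes given by [G] lie below [g]. It passes
    directly to averages of losses. *)
Definition supporting (R : realType) (d : nat) (g : 'rV[R]_d -> R)
    (G : 'rV[R]_d -> 'rV[R]_d) : Prop :=
  forall x y, g x + dotv (G x) (y - x) <= g y.

Section smooth_convex.
Variables (R : realType) (d : nat).
Implicit Types (g : 'rV[R]_d -> R) (G : 'rV[R]_d -> 'rV[R]_d).

(** By convexity on the segment from [x] to [y], the difference quotients with step in [(0, 1]] are
    at most [g y - g x]; the step then tends to [0] from the right. *)
Lemma convex_gradient_supporting g G :
  convex_fun g -> is_gradient g G -> supporting g G.
Proof.
move=> cg gG x y; have [dg dgE] := gG x.
rewrite -lerBrDl -dgE -deriveE//.
have := @diff_derivable _ _ _ g x (y - x) dg; rewrite /derivable => /cvg_dnbhs_at_right gc.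
apply: (cvgr_to_le gc); near=> h => /=.
have h0 : 0 < h by near: h; exact: nbhs_right_gt.
have h1 : h <= 1 by near: h; exact: nbhs_right_ltW.
rewrite /GRing.scale/= ler_pdivrMl//.
have := cg y x h; rewrite (ltW h0) h1 => /(_ isT).
have -> : h *: y + (1 - h) *: x = h *: (y - x) + x.
  by rewrite scalerBr scalerBl scale1r [x - _]addrC addrA.
by lra.
Unshelve. all: by end_near. Qed.

Variables (g : 'rV[R]_d -> R) (G : 'rV[R]_d -> 'rV[R]_d) (beta : R).
Hypotheses (beta0 : 0 < beta) (gG : supporting g G) (sG : smooth_grad G beta).

(* Convexity gives the quadratic upper bound with [beta] in place of the
   optimal [beta / 2], without integrating the gradient. *)
Lemma smooth_upper x y :
  g y <= g x + dotv (G x) (y - x) + beta * sqnorm (y - x).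
Proof.
have := gG y x; have := cauchy_schwarz (G y - G x) (y - x).
have := sG y x; have := norm2_ge0 (y - x).
rewrite -(opprB y x) !dotvE -sqr_norm2; nra.
Qed.

(** At the auxiliary point [z], [g] is bounded below by the tangent at [x] and above by
    [smooth_upper] at [y]. The choice [h = (2 * beta)^-1] maximizes the gain [h - beta * h ^+ 2],
    whose value is [(4 * beta)^-1]. *)
Lemma sqnorm_gradient_gap x y :
  g x + dotv (G x) (y - x) + (4 * beta)^-1 * sqnorm (G x - G y) <= g y.
Proof.
pose h := (2 * beta)^-1; pose z := y - h *: (G y - G x).
have := gG x z; have := smooth_upper y z.
have -> : z - y = - (h *: (G y - G x)) by rewrite /z addrC addKr.
have -> : z - x = (y - x) - h *: (G y - G x) by rewrite /z addrAC.
have -> : sqnorm (- (h *: (G y - G x))) = h ^+ 2 * sqnorm (G x - G y).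
  by rewrite sqnormN sqnormZ sqnormBC.
have -> : dotv (G x) (y - x - h *: (G y - G x)) =
    dotv (G x) (y - x) - h * dotv (G x) (G y - G x) by rewrite !dotvE; ring.
have : dotv (G y) (- (h *: (G y - G x))) + h * dotv (G x) (G y - G x) =
    - h * sqnorm (G x - G y) by rewrite /sqnorm !dotvE (dotvC (G y) (G x)); ring.
have <- : h - beta * h ^+ 2 = (4 * beta)^-1 by rewrite /h; field; exact: lt0r_neq0.
by nra.
Qed.

(** A step of length [(2 * beta)^-1] along [- G w] lowers [g] by at least
    [(4 * beta)^-1 * sqnorm (G w)], yet cannot bring it below [m]. *)
Lemma sqnorm_gradient_le m w :
  (forall w', m <= g w') -> sqnorm (G w) <= 4 * beta * (g w - m).
Proof.
move=> gm; pose h := (2 * beta)^-1.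
have := smooth_upper w (w - h *: G w); have := gm (w - h *: G w).
have -> : w - h *: G w - w = - (h *: G w) by rewrite addrC addKr.
have -> : sqnorm (- (h *: G w)) = h ^+ 2 * sqnorm (G w).
  by rewrite sqnormN sqnormZ.
have -> : dotv (G w) (- (h *: G w)) = - (h * sqnorm (G w)).
  by rewrite !dotvE.
move=> g1 g2.
have : (4 * beta)^-1 * sqnorm (G w) <= g w - m.
  have <- : h - beta * h ^+ 2 = (4 * beta)^-1 by rewrite /h; field; exact: lt0r_neq0.
  by nra.
by rewrite ler_pdivrMl// mulr_gt0.
Qed.

(** Adding the gap inequalities for [(x, y)] and [(y, x)] gives cocoercivity of [G] with constant
    [(2 * beta)^-1]. In the expanded square, the inner product then absorbs the term in
    [eta ^+ 2]. *)
Lemma gradient_step_nonexpansive eta x y : 0 <= eta <= (2 * beta)^-1 ->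
  norm2 ((x - eta *: G x) - (y - eta *: G y)) <= norm2 (x - y).
Proof.
move=> /andP[eta0 etab]; rewrite norm2_le.
have := sqnorm_gradient_gap x y; have := sqnorm_gradient_gap y x.
rewrite -(opprB (G x) (G y)) sqnormN -(opprB x y).
have -> : (x - eta *: G x) - (y - eta *: G y) = (x - y) - eta *: (G x - G y).
  by rewrite opprB scalerBr opprB [_ *: G y - y]addrC addrACA
    [- _ + eta *: G y]addrC.
rewrite sqnormBZ dotvDl !dotvNr dotvNl; have s0 := sqnorm_ge0 (G x - G y).
have <- : (2 * beta)^-1 / 2 = (4 * beta)^-1 by field; exact: lt0r_neq0.
move: etab s0; set K := (2 * beta)^-1; set s := sqnorm _ => etab s0 g1 g2.
have : 0 <= eta * (K - eta) * s by rewrite !mulr_ge0// subr_ge0.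
have : 0 <= eta * (dotv (G x) (x - y) - dotv (G y) (x - y) - K * s).
  by rewrite mulr_ge0//; lra.
by nra.
Qed.

(** Since the gradient vanishes at [ws], the gap inequality leaves a surplus
    [(4 * beta)^-1 * sqnorm (G w)]. Multiplied by [2 * eta], it covers [eta ^+ 2 * sqnorm (G w)]
    because [eta <= (2 * beta)^-1]. *)
Lemma gradient_step_dist_minimizer eta w ws : 0 <= eta <= (2 * beta)^-1 ->
  (forall w', g ws <= g w') ->
  sqnorm (w - eta *: G w - ws) <= sqnorm (w - ws) - 2 * eta * (g w - g ws).
Proof.
move=> /andP[eta0 etab] wsmin.
(* The self-bounding inequality with [m = g ws] forces the gradient at a minimizer to vanish. *)
have Gws : norm2 (G ws) = 0.
  have := sqnorm_gradient_le ws wsmin; rewrite subrr mulr0 => s0.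
  by rewrite /norm2 ler0_sqrtr.
have Gw0 : dotv (G ws) (G w) = 0.
  apply/eqP; rewrite eq_le; have := cauchy_schwarz (G ws) (G w).
  have := cauchy_schwarz (- G ws) (G w).
  by rewrite dotvNl norm2N Gws mul0r oppr_le0 => -> ->.
have := sqnorm_gradient_gap w ws.
have -> : sqnorm (G w - G ws) = sqnorm (G w).
  have ss := sqr_norm2 (G ws); rewrite Gws expr0n/= in ss.
  by rewrite /sqnorm !dotvE (dotvC (G w)) Gw0 -/(sqnorm (G ws)) -ss; ring.
rewrite (addrAC w (- _)) sqnormBZ.
have <- : (2 * beta)^-1 / 2 = (4 * beta)^-1 by field; exact: lt0r_neq0.
move: etab; set K := (2 * beta)^-1; set s := sqnorm (G w) => etab g1.
have : 0 <= eta * (K - eta) * s by rewrite !mulr_ge0 ?sqnorm_ge0// subr_ge0.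
have : 0 <= eta * (g ws - (g w + dotv (G w) (ws - w) + K / 2 * s)).
  by rewrite mulr_ge0// subr_ge0.
rewrite -(opprB w ws) dotvNr; nra.
Qed.

End smooth_convex.

(** * Deterministic trajectories: regret and stability *)

Section gradient_descent.
Variables (R : realType) (d : nat) (Z : Type) (n : nat).
Variables (f : 'rV[R]_d -> Z -> R) (gradf : 'rV[R]_d -> Z -> 'rV[R]_d).
Implicit Types (Q : pred 'I_n) (s : 'I_n -> Z) (w : 'rV[R]_d).

(** The divisor stays [n] even when [Q] drops examples, so the remaining terms of a full-batch step
    form the gradient of such a function, still [beta]-smooth. *)
Definition avg_loss Q s w : R := n%:R^-1 * \sum_(j < n | Q j) f w (s j).

Definition avg_grad Q s w : 'rV[R]_d :=
  n%:R^-1 *: \sum_(j < n | Q j) gradf w (s j).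

Lemma supporting_avg Q s :
  (forall z, supporting (f^~ z) (gradf^~ z)) ->
  supporting (avg_loss Q s) (avg_grad Q s).
Proof.
move=> fG x y; rewrite /avg_loss dotvZl dotv_suml -mulrDr -big_split/=.
by rewrite ler_wpM2l ?invr_ge0 ?ler0n// ler_sum// => j _; exact: fG.
Qed.

Lemma smooth_avg (beta : R) Q s : 0 <= beta ->
  (forall z, smooth_grad (gradf^~ z) beta) -> smooth_grad (avg_grad Q s) beta.
Proof.
move=> beta0 fG x y; rewrite -scalerBr norm2Z ?invr_ge0 ?ler0n// -sumrB.
apply: (@le_trans _ _ (n%:R^-1 * \sum_(j < n) (beta * norm2 (x - y)))).
  rewrite ler_wpM2l ?invr_ge0 ?ler0n//.
  apply: le_trans (norm2_sum _ _ _) _; rewrite [leRHS](bigID Q)/=.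
  rewrite -[leLHS]addr0 lerD ?ler_sum//; first by move=> j _; exact: fG.
  by rewrite sumr_ge0// => j _; rewrite mulr_ge0 ?norm2_ge0.
rewrite sumr_const card_ord -[X in _ * X <= _]mulr_natl.
(* For [n = 0] the inverse is [0] by convention. *)
have [->|n0] := posnP n; first by rewrite invr0 mul0r mulr_ge0 ?norm2_ge0.
by rewrite mulKf ?pnatr_eq0 -?lt0n.
Qed.

Variables (eta : nat -> R) (W1 : 'rV[R]_d).
Local Notation W := (gd_iter gradf eta W1).

Lemma gd_iterS s k :
  W s k.+1 = W s k - eta k.+1 *: avg_grad xpredT s (W s k).
Proof. by rewrite /= scalerA. Qed.

Lemma gd_iter_perm s (p : {perm 'I_n}) k : W (s \o p) k = W s k.
Proof.
elim: k => //= k ->; congr (_ - _ *: _).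
by rewrite [RHS](reindex_inj (@perm_inj _ p)).
Qed.

Variables (beta : R) (T : nat).
Hypotheses (beta0 : 0 < beta).
Hypothesis fG : forall z, supporting (f^~ z) (gradf^~ z).
Hypothesis smoothG : forall z, smooth_grad (gradf^~ z) beta.
Hypothesis eta_bound : forall t, (1 <= t <= T)%N -> 0 <= eta t <= (2 * beta)^-1.

Lemma eta_ge0 t : (1 <= t <= T)%N -> 0 <= eta t.
Proof. by move=> /eta_bound /andP[]. Qed.

Lemma gd_regret s ws : (forall w, emp_risk f s ws <= emp_risk f s w) ->
  2 * \sum_(1 <= t < T.+1)
      eta t * (emp_risk f s (gdW gradf eta W1 s t) - emp_risk f s ws)
    <= sqnorm (W1 - ws).
Proof.
(* Keeping the current distance to [ws] in the claim makes the one-step inequality telescope. Here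
   [W s k] is the iterate of index [k + 1], reached after step [k]. *)
move=> wsmin; suff : forall k, (k <= T)%N -> 2 * \sum_(1 <= t < k.+1)
      eta t * (emp_risk f s (gdW gradf eta W1 s t) - emp_risk f s ws)
    <= sqnorm (W1 - ws) - sqnorm (W s k - ws).
  by move=> /(_ _ (leqnn T))/le_trans; apply; rewrite lerBlDr lerDl sqnorm_ge0.
elim=> [_|k IH kT]; first by rewrite big_geq// mulr0 subrr.
rewrite big_nat_recr//= mulrDr.
have := gradient_step_dist_minimizer beta0 (supporting_avg xpredT s fG)
  (smooth_avg xpredT s (ltW beta0) smoothG) (W s k)
  (@eta_bound k.+1 kT) wsmin.
rewrite -gd_iterS /gdW/=; have := IH (ltnW kT); rewrite /emp_risk /avg_loss; lra.
Qed.

Lemma gd_stability s s' i : (forall j, j != i -> s j = s' j) ->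
  norm2 (W s T - W s' T) <= n%:R^-1 * \sum_(1 <= t < T.+1)
    eta t * (norm2 (gradf (gdW gradf eta W1 s t) (s i))
             + norm2 (gradf (gdW gradf eta W1 s' t) (s' i))).
Proof.
move=> ss'; suff : forall k, (k <= T)%N -> norm2 (W s k - W s' k) <=
    n%:R^-1 * \sum_(1 <= t < k.+1)
    eta t * (norm2 (gradf (gdW gradf eta W1 s t) (s i))
             + norm2 (gradf (gdW gradf eta W1 s' t) (s' i))) by exact.
elim=> [_|k IH kT]; first by rewrite subrr norm2_0 big_geq// mulr0.
rewrite big_nat_recr//= mulrDr /gdW/=.
set w := W s k; set w' := W s' k; set e := eta k.+1.
set g := gradf w (s i); set g' := gradf w' (s' i).
pose Q := predC1 i.
have e0 : 0 <= e by exact: eta_ge0.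
(* A full-batch step is the step on the average without example [i], followed by a shift along the
   gradient at [i]. The first part is the same nonexpansive map for both samples. *)
have stepE s0 w0 : w0 - (e / n%:R) *: \sum_(j < n) gradf w0 (s0 j) =
    (w0 - e *: avg_grad Q s0 w0) - (e / n%:R) *: gradf w0 (s0 i).
  rewrite (bigD1 i)//= scalerDr opprD addrCA addrC /avg_grad scalerA.
  by rewrite -addrA.
rewrite !stepE -/g -/g'.
have -> : avg_grad Q s' w' = avg_grad Q s w'.
  by congr (_ *: _); apply: eq_bigr => j ji; rewrite ss'.
set a := w - _; set b := w' - _.
have -> : a - (e / n%:R) *: g - (b - (e / n%:R) *: g') =
    (a - b) + ((e / n%:R) *: g' + - ((e / n%:R) *: g)).
  by rewrite opprB [_ *: g' - b]addrC addrACA [- _ + _ *: g']addrC.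
apply: le_trans (norm2_triangle _ _) _; apply: lerD.
  apply: le_trans (IH (ltnW kT)).
  exact: (gradient_step_nonexpansive beta0 (supporting_avg Q s fG)
   (smooth_avg Q s (ltW beta0) smoothG) _ _ (@eta_bound k.+1 kT)).
apply: le_trans (norm2_triangle _ _) _.
by rewrite norm2N !norm2Z ?divr_ge0 ?ler0n//; lra.
Qed.

(** Cauchy-Schwarz with weights [eta t], applied to [1] and [a t + b t], produces the sum of the
    step sizes. The factor [2] comes from bounding [(a t + b t) ^+ 2] by
    [2 * (a t ^+ 2 + b t ^+ 2)]. *)
Lemma gd_stability_sq s s' i : (forall j, j != i -> s j = s' j) ->
  sqnorm (W s T - W s' T) <=
    2 * (\sum_(1 <= t < T.+1) eta t) / n%:R ^+ 2 * \sum_(1 <= t < T.+1)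
    eta t * (sqnorm (gradf (gdW gradf eta W1 s t) (s i))
             + sqnorm (gradf (gdW gradf eta W1 s' t) (s' i))).
Proof.
move=> /gd_stability.
set a := fun t => norm2 (gradf (gdW gradf eta W1 s t) (s i)).
set b := fun t => norm2 (gradf (gdW gradf eta W1 s' t) (s' i)) => st.
have eta0 t : (1 <= t < T.+1)%N -> 0 <= eta t by exact: eta_ge0.
have := lerXn2r 2 (norm2_ge0 _) (le_trans (norm2_ge0 _) st) st.
rewrite sqr_norm2 => /le_trans; apply; rewrite exprMn exprVn.
rewrite [leRHS](_ : _ = (n%:R ^+ 2)^-1 * ((\sum_(1 <= t < T.+1) eta t) *
  (2 * \sum_(1 <= t < T.+1) eta t * (a t ^+ 2 + b t ^+ 2)))); last first.
  have -> : \sum_(1 <= t < T.+1) eta t * (a t ^+ 2 + b t ^+ 2) =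
      \sum_(1 <= t < T.+1)
      eta t * (sqnorm (gradf (gdW gradf eta W1 s t) (s i))
               + sqnorm (gradf (gdW gradf eta W1 s' t) (s' i))).
    by apply: eq_bigr => t _; rewrite /a /b !sqr_norm2.
  by ring.
rewrite ler_wpM2l ?invr_ge0 ?exprn_ge0 ?ler0n//.
(* The range is repeated in the predicate because [eta] is known to be nonnegative only there. *)
have := @weighted_cauchy_schwarz R _ (index_iota 1 T.+1)
  (fun t => (1 <= t < T.+1)%N) eta (fun=> 1) (fun t => a t + b t) eta0.
rewrite -!big_nat; under eq_bigr do rewrite mul1r.
under [X in _ <= X * _]eq_bigr do rewrite expr1n mulr1.
move=> /le_trans; apply; rewrite ler_wpM2l//.
  by rewrite big_nat sumr_ge0.
rewrite big_distrr/= big_nat [leRHS]big_nat ler_sum// => t /eta0 t0.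
by rewrite [leRHS]mulrCA ler_wpM2l//; have := sqr_ge0 (a t - b t); lra.
Qed.

End gradient_descent.

(** * Measurability of Carathéodory functions along measurable arguments *)

Section caratheodory.
Variables (R : realType) (d : nat).

(** Integer label of the grid cell of mesh [1 / (k + 1)] containing [w]; there are only countably
    many labels. *)
Definition grid_index (k : nat) (w : 'rV[R]_d) : 'rV[int]_d :=
  \row_j Num.floor (k.+1%:R * w ord0 j).

Definition grid_point (k : nat) (v : 'rV[int]_d) : 'rV[R]_d :=
  \row_j ((v ord0 j)%:~R / k.+1%:R).

Lemma grid_point_cvg (w : 'rV[R]_d) :
  grid_point k (grid_index k w) @[k --> \oo] --> w.
Proof.
apply/cvgrPdist_le => e e0.
near=> k.
have k0 : 0 < k.+1%:R :> R by [].
rewrite (_ : `|_| = mx_norm (w - grid_point k (grid_index k w)))// mx_normrE.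
apply: bigmax_le => [|[i j] _]; first exact: ltW.
rewrite !mxE !ord1/=.
have /andP[fl fu] := floor_itv (k.+1%:R * w ord0 j).
have wE : w ord0 j = k.+1%:R * w ord0 j / k.+1%:R by rewrite mulrAC divff ?mul1r.
rewrite {1}wE.
rewrite -mulrBl normrM normfV [`|k.+1%:R|]ger0_norm// ler_pdivrMr//.
rewrite ger0_norm ?subr_ge0//; apply: (@le_trans _ _ 1).
  by move: fu; rewrite intrD lerBlDl => /ltW.
rewrite -ler_pdivrMr// div1r.
apply: ltW; near: k; exact: near_infty_natSinv_lt (PosNum e0).
Unshelve. all: by end_near. Qed.

(** Rounding [W] to the grid gives functions that converge pointwise by continuity in [w], and a
    pointwise limit of measurable functions is measurable. *)
Lemma measurable_caratheodory (dO dZ : measure_display)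
    (O : measurableType dO) (Z : measurableType dZ)
    (h : 'rV[R]_d -> Z -> R) (W : O -> 'rV[R]_d) (X : O -> Z) :
  (forall z, continuous (h^~ z)) -> (forall w, measurable_fun setT (h w)) ->
  (forall j, measurable_fun setT (fun o => W o ord0 j)) ->
  measurable_fun setT X -> measurable_fun setT (fun o => h (W o) (X o)).
Proof.
move=> ch mh mW mX.
apply: (@measurable_fun_cvg _ _ _ _
    (fun k o => h (grid_point k (grid_index k (W o))) (X o))); last first.
  move=> o _.
  exact: (cvg_comp _ _ (@grid_point_cvg (W o)) (ch (X o) (W o))).
move=> k _ Y mY; rewrite setTI.
(* The preimage is cut along the countably many cells. On each cell the first argument is the
   constant [grid_point k v], so measurability in [z] applies. *)
rewrite (_ : _ @^-1` _ = \bigcup_(v in [set: 'rV[int]_d])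
  ((\bigcap_(j in [set: 'I_d])
     [set o | Num.floor (k.+1%:R * W o ord0 j) == v ord0 j]) `&`
   ((fun o => h (grid_point k v) (X o)) @^-1` Y))); last first.
  apply/seteqP; split => o.
    by move=> Yo; exists (grid_index k (W o)) => //; split => // j _ /=; rewrite mxE.
  case=> v _ [ov Yv] /=; rewrite (_ : grid_index k (W o) = v)//.
  by apply/rowP => j; rewrite mxE; apply/eqP; exact: ov.
apply: countable_bigcupT_measurable => [|v]; first exact: countableP.
apply: measurableI.
  apply: fin_bigcap_measurable => [|j _]; first exact: finite_finset.
  pose a (o : O) := k.+1%:R * W o ord0 j.
  rewrite (_ : [set _ | _] = a @^-1` `[(v ord0 j)%:~R, (v ord0 j + 1)%:~R[).
    rewrite -[X in measurable X]setTI.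
    by apply: measurable_funM.
  by apply/seteqP; split => o /=; rewrite floor_eq in_itv.
by rewrite -[X in measurable X]setTI; apply: (measurableT_comp (mh _) mX).
Qed.

End caratheodory.

(** * Exchangeability of an i.i.d. sample *)

Section exchangeability.
Variables (R : realType) (dO dZ : measure_display).
Variables (O : measurableType dO) (P : probability O R).
Variables (Z : measurableType dZ) (D : probability Z R) (m : nat).

(** A pi-system generating the product sigma-algebra; these are the events whose probability
    [iid_law] prescribes. *)
Definition tuple_rectangles : set (set (m.-tuple Z)) :=
  [set A | exists2 B : 'I_m -> set Z, (forall j, measurable (B j)) &
    A = \bigcap_(j in [set: 'I_m]) ((fun t => tnth t j) @^-1` B j)].

Lemma measurable_tuple_rectangles :
  measurable = <<s tuple_rectangles >> :> set (set (m.-tuple Z)).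
Proof.
apply/seteqP; split; apply: smallest_sub.
- exact: smallest_sigma_algebra.
- rewrite -bigcup_seq => A [j _ [B mB <-]]; apply: sub_sigma_algebra.
  exists (fun k => if k == j then B else setT).
    by move=> k; case: ifP.
  apply/seteqP; split => [t [_ tB] k _ /=|t /(_ j Logic.I)/=].
    by case: eqP => // ->.
  by rewrite eqxx.
- exact: sigma_algebra_measurable.
- move=> _ [B mB ->]; apply: fin_bigcap_measurable => [|j _].
    exact: finite_finset.
  by rewrite -[X in measurable X]setTI; exact: measurable_tnth.
Qed.

Lemma tuple_rectangles_setI : setI_closed tuple_rectangles.
Proof.
move=> _ _ [A mA ->] [B mB ->]; exists (fun j => A j `&` B j).
  by move=> j; exact: measurableI.
by rewrite -bigcapI.
Qed.

Variables (X : 'I_m -> O -> Z).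
Hypothesis iidX : iid_law P D X.

Lemma measurable_sample (p : 'I_m -> 'I_m) :
  measurable_fun setT (fun o => [tuple X (p j) o | j < m]).
Proof.
apply/measurable_fun_tnthP => j; rewrite (_ : _ \o _ = X (p j)).
  exact: iidX.1.
by apply/funext => o /=; rewrite tnth_mktuple.
Qed.

(** Both expectations are integrals of [g] against laws on tuples. These agree on rectangles, where
    the product of the [D (B j)] ignores the order, hence everywhere by uniqueness of measures on a
    generating pi-system. *)
Lemma iid_exchangeable (p : {perm 'I_m}) (g : m.-tuple Z -> R) :
  measurable_fun setT g -> (forall t, 0 <= g t) ->
  ('E_P[fun o => g [tuple X (p j) o | j < m]] =
   'E_P[fun o => g [tuple X j o | j < m]])%E.
Proof.
move=> mg g0; rewrite unlock.
pose Xp (q : 'I_m -> 'I_m) : {mfun O >-> m.-tuple Z} :=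
  HB.pack (fun o => [tuple X (q j) o | j < m])
    (isMeasurableFun.Build _ _ _ _ _ (measurable_sample q)).
have mgE : measurable_fun setT (EFin \o g) by exact/measurable_EFinP.
rewrite -[LHS](ge0_integral_distribution (Xp p) mgE)//.
rewrite -[RHS](ge0_integral_distribution (Xp id) mgE)//.
apply: eq_measure_integral => A mA _.
apply: (measure_unique tuple_rectangles (fun=> setT)) => //.
- exact: measurable_tuple_rectangles.
- exact: tuple_rectangles_setI.
- move=> _; exists (fun=> setT) => //.
  by apply/seteqP; split.
- exact: bigcup_const.
- move=> _ [B mB ->].
  have XB (q : {perm 'I_m}) : distribution P (Xp q) (\bigcap_(j in [set: 'I_m])
      ((fun t => tnth t j) @^-1` B j)) = (\prod_(j < m) D (B j))%E.
    rewrite /distribution /pushforward/=.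
    (* Permuting the variables amounts to permuting the sides of the rectangle by the inverse. *)
    rewrite [X in P X](_ : _ = \bigcap_(j in [set: 'I_m])
        (X j @^-1` B ((q^-1)%g j))).
      by rewrite iidX.2// [RHS](reindex_inj (@perm_inj _ (q^-1)%g)).
    apply/seteqP; split => o /= oB j _ /=.
      by have := oB ((q^-1)%g j) Logic.I; rewrite /= tnth_mktuple permKV.
    by have := oB (q j) Logic.I; rewrite /= tnth_mktuple permK.
  apply: (eq_trans (XB p)); rewrite -(XB 1%g); congr (P _); apply/seteqP.
  by split => o /= oB j _ /=; have := oB j Logic.I; rewrite /= !tnth_mktuple perm1.
- by move=> _; rewrite (le_lt_trans (probability_le1 _ _))// ltry.
Qed.

End exchangeability.

(** * Expectations of nonnegative variables, possibly infinite *)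

Section expectation_nonnegative.
Local Open Scope ereal_scope.
Variables (R : realType) (dO : measure_display) (O : measurableType dO).
Variable P : probability O R.
Implicit Types X Y : O -> R.

Lemma ge0_expectation_le X Y :
  measurable_fun setT X -> measurable_fun setT Y ->
  (forall o, 0 <= X o <= Y o)%R -> 'E_P[X] <= 'E_P[Y].
Proof.
move=> mX mY XY; rewrite unlock; apply: ge0_le_integral => //.
- by move=> o _; rewrite lee_fin; case/andP: (XY o).
- exact/measurable_EFinP.
- exact/measurable_EFinP.
- by move=> o _; rewrite lee_fin; case/andP: (XY o).
Qed.

Lemma ge0_expectationD X Y :
  measurable_fun setT X -> measurable_fun setT Y ->
  (forall o, 0 <= X o)%R -> (forall o, 0 <= Y o)%R ->
  'E_P[fun o => (X o + Y o)%R] = 'E_P[X] + 'E_P[Y].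
Proof.
move=> mX mY X0 Y0; rewrite unlock -ge0_integralD//.
- by move=> o _; rewrite lee_fin.
- exact/measurable_EFinP.
- by move=> o _; rewrite lee_fin.
- exact/measurable_EFinP.
Qed.

Lemma ge0_expectationZl X k : measurable_fun setT X ->
  (forall o, 0 <= X o)%R -> (0 <= k)%R ->
  'E_P[fun o => (k * X o)%R] = k%:E * 'E_P[X].
Proof.
move=> mX X0 k0; rewrite unlock -ge0_integralZl_EFin//.
- by move=> o _; rewrite lee_fin.
- exact/measurable_EFinP.
Qed.

(** Nonnegativity is asked only for indices in [r], since step sizes are controlled only on a range
    of times. *)
Lemma ge0_expectation_sum (I : eqType) (r : seq I) (F : I -> O -> R) :
  (forall i, measurable_fun setT (F i)) ->
  (forall i, i \in r -> forall o, 0 <= F i o)%R ->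
  'E_P[fun o => (\sum_(i <- r) F i o)%R] = \sum_(i <- r) 'E_P[F i].
Proof.
move=> mF; elim: r => [|i r IH] F0.
  under [in LHS]eq_fun do rewrite big_nil.
  by rewrite big_nil; exact: expectation_cst.
under [in LHS]eq_fun do rewrite big_cons.
rewrite big_cons ge0_expectationD//.
- by rewrite IH// => j jr; apply: F0; rewrite inE jr orbT.
- exact: measurable_sum.
- by apply: F0; rewrite inE eqxx.
- move=> o; rewrite big_seq sumr_ge0// => j jr.
  by apply: F0; rewrite inE jr orbT.
Qed.

Lemma expectation_ge0 X : (forall o, 0 <= X o)%R -> 0 <= 'E_P[X].
Proof. by move=> X0; rewrite unlock integral_ge0// => o _; rewrite lee_fin. Qed.

End expectation_nonnegative.

(** * Measurability of the iterates as functions of the sample *)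

Section measurable_gradient_descent.
Variables (R : realType) (d : nat).

Lemma smooth_grad_continuous (G : 'rV[R]_d -> 'rV[R]_d) (beta : R) (j : 'I_d) :
  0 <= beta -> smooth_grad G beta -> continuous (fun w => G w ord0 j).
Proof.
move=> beta0 sG w; apply/(@cvgrPdist_le _ _ _ _ (nbhs_filter w)) => e e0.
(* A Lipschitz constant for the maximum norm, increased by [1] to be positive so that [e / C] makes
   sense. *)
pose C := beta * Num.sqrt d%:R + 1.
have C0 : 0 < C by rewrite ltr_wpDl// mulr_ge0// sqrtr_ge0.
have wC : \forall u \near w, `|w - u| <= e / C.
  exact: (@cvgr_dist_le _ _ _ _ (nbhs_filter w) id w cvg_id _ (divr_gt0 e0 C0)).
near=> u; have wu : `|w - u| <= e / C by near: u.
have -> : G w ord0 j - G u ord0 j = (G w - G u) ord0 j by rewrite !mxE.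
apply: le_trans (abs_coord_le_norm2 _ _) _; apply: le_trans (sG _ _) _.
apply: le_trans (ler_wpM2l beta0 (norm2_le_mx_norm _)) _.
apply: (@le_trans _ _ (C * `|w - u|)).
  by rewrite mulrA ler_wpM2r// /C lerDl.
by rewrite mulrC -ler_pdivlMr.
Unshelve. all: by end_near. Qed.

Variables (dO dZ : measure_display) (O : measurableType dO).
Variables (Z : measurableType dZ).

Lemma measurable_sqnorm (V : O -> 'rV[R]_d) :
  (forall j, measurable_fun setT (fun o => V o ord0 j)) ->
  measurable_fun setT (fun o => sqnorm (V o)).
Proof. by move=> mV; apply: measurable_sum => j; exact: measurable_funM. Qed.

Lemma measurable_emp_risk (n : nat) (f : 'rV[R]_d -> Z -> R)
    (s : O -> 'I_n -> Z) (W : O -> 'rV[R]_d) :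
  (forall z, continuous (f^~ z)) -> (forall w, measurable_fun setT (f w)) ->
  (forall k, measurable_fun setT (fun o => s o k)) ->
  (forall j, measurable_fun setT (fun o => W o ord0 j)) ->
  measurable_fun setT (fun o => emp_risk f (s o) (W o)).
Proof.
move=> cf mf ms mW; apply: measurable_funM => //.
apply: measurable_sum => k.
exact: (@measurable_caratheodory _ _ _ _ _ _ f W (fun o => s o k)).
Qed.

Variable gradf : 'rV[R]_d -> Z -> 'rV[R]_d.
Variables (beta : R).
Hypothesis beta0 : 0 <= beta.
Hypothesis smoothG : forall z, smooth_grad (gradf^~ z) beta.
Hypothesis mgradf : forall w j, measurable_fun setT (fun z => gradf w z ord0 j).

Lemma measurable_gradient (W : O -> 'rV[R]_d) (X : O -> Z) :
  (forall j, measurable_fun setT (fun o => W o ord0 j)) ->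
  measurable_fun setT X ->
  forall j, measurable_fun setT (fun o => gradf (W o) (X o) ord0 j).
Proof.
move=> mW mX j.
apply: (@measurable_caratheodory _ _ _ _ _ _ (fun w z => gradf w z ord0 j)) => //.
by move=> z; exact: smooth_grad_continuous (smoothG z).
Qed.

Lemma measurable_gd (n : nat) (eta : nat -> R) (W1 : 'rV[R]_d)
    (s : O -> 'I_n -> Z) :
  (forall k, measurable_fun setT (fun o => s o k)) ->
  forall t j, measurable_fun setT (fun o => gdW gradf eta W1 (s o) t ord0 j).
Proof.
move=> ms t; rewrite /gdW; elim: t.-1 => [j|k IH j]; first exact: measurable_cst.
rewrite (_ : (fun o => _) = (fun o => gd_iter gradf eta W1 (s o) k ord0 j -
    (eta k.+1 / n%:R) *
    \sum_(l < n) gradf (gd_iter gradf eta W1 (s o) k) (s o l) ord0 j)).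
  apply: measurable_funB => //; apply: measurable_funM => //.
  by apply: measurable_sum => l; apply: measurable_gradient.
by apply/funext => o; rewrite /= !mxE summxE.
Qed.

End measurable_gradient_descent.

(** Serves the degenerate case [beta = 0], where the step-size bound [(2 * beta)^-1] is [0]. *)
Lemma gd_iter_eta0 (R : realType) (d : nat) (Z : Type) (n : nat)
    (gradf : 'rV[R]_d -> Z -> 'rV[R]_d) (eta : nat -> R) (W1 : 'rV[R]_d)
    (s : 'I_n -> Z) (T : nat) :
  (forall t, (1 <= t <= T)%N -> eta t = 0) -> gd_iter gradf eta W1 s T = W1.
Proof.
elim: T => // T IH eta0 /=; rewrite eta0 ?leqnn// mul0r scale0r subr0 IH// => t.
by case/andP=> t1 tT; rewrite eta0// t1 ltnW.
Qed.

Lemma widen_ord_inj (m n : nat) (le_mn : (m <= n)%N) :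
  injective (widen_ord le_mn).
Proof. by move=> i j /(congr1 val) ij; exact: val_inj. Qed.

(** * Symmetries of the expected squared gradients *)

Section expected_gradients.
Variables (R : realType) (dO dZ : measure_display).
Variables (O : measurableType dO) (P : probability O R).
Variables (Z : measurableType dZ) (D : probability Z R) (d n : nat).
Variables (Zs : 'I_n.+1 -> O -> Z) (gradf : 'rV[R]_d -> Z -> 'rV[R]_d).
Variables (beta : R) (eta : nat -> R) (W1 : 'rV[R]_d).
Hypothesis iidZ : iid_law P D Zs.
Hypothesis beta0 : 0 <= beta.
Hypothesis smoothG : forall z, smooth_grad (gradf^~ z) beta.
Hypothesis mgradf : forall w j, measurable_fun setT (fun z => gradf w z ord0 j).

Let S o := fun k : 'I_n => Zs (widen_ord (leqnSn n) k) o.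
Let grad_sq (s : 'I_n -> Z) (i : 'I_n) t : R :=
  sqnorm (gradf (gdW gradf eta W1 s t) (s i)).

Lemma measurable_grad_sq (dT : measure_display) (U : measurableType dT)
    (s : U -> 'I_n -> Z) i t :
  (forall k, measurable_fun setT (fun o => s o k)) ->
  measurable_fun setT (fun o => grad_sq (s o) i t).
Proof.
move=> ms; apply: measurable_sqnorm; apply: (measurable_gradient beta0) => //.
exact: (measurable_gd beta0).
Qed.

(** The permutation acts on all [n + 1] draws, so it may also move the replacement example into the
    training sample. *)
Lemma expected_grad_sq_perm (p : {perm 'I_n.+1}) i t :
  ('E_P[fun o => grad_sq (fun k => Zs (p (widen_ord (leqnSn n) k)) o) i t] =
   'E_P[fun o => grad_sq (S o) i t])%E.
Proof.
pose g (x : n.+1.-tuple Z) :=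
  grad_sq (fun k => tnth x (widen_ord (leqnSn n) k)) i t.
have mg : measurable_fun setT g.
  by apply: measurable_grad_sq => k; exact: measurable_tnth.
have := iid_exchangeable iidZ p mg (fun x => sqnorm_ge0 _).
have gE q : (fun o => g [tuple Zs (q j) o | j < n.+1]) =
    (fun o => grad_sq (fun k => Zs (q (widen_ord (leqnSn n) k)) o) i t).
  apply/funext => o; rewrite /g; congr (grad_sq _ i t).
  by apply/funext => k; rewrite tnth_mktuple.
by rewrite (gE p) (gE id).
Qed.

(** Exchanging the draws [i] and [ord_max] turns the first [n] draws into the perturbed sample. *)
Lemma expected_grad_sq_replace i t :
  ('E_P[fun o => grad_sq (replace_at (S o) i (Zs ord_max o)) i t] =
   'E_P[fun o => grad_sq (S o) i t])%E.
Proof.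
rewrite -(expected_grad_sq_perm (tperm (widen_ord (leqnSn n) i) ord_max)).
congr expectation; apply/funext => o; congr (grad_sq _ i t); apply/funext => k.
rewrite /replace_at; case: eqP => [->|/eqP ki]; first by rewrite tpermL.
rewrite tpermD//; first by rewrite eq_sym (inj_eq (@widen_ord_inj _ _ _)).
by rewrite -val_eqE/= gtn_eqF.
Qed.

(** Swapping examples [i] and [j] leaves the full-batch iterates unchanged and moves the gradient
    from one example to the other, so all [n] expectations coincide. *)
Lemma expected_grad_sq_avg i t :
  ('E_P[fun o => n%:R^-1 * \sum_(j < n) grad_sq (S o) j t]%R =
   'E_P[fun o => grad_sq (S o) i t])%E.
Proof.
have mS k : measurable_fun setT (fun o => S o k) by exact: iidZ.1.
have sq0 j o : 0 <= grad_sq (S o) j t by exact: sqnorm_ge0.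
rewrite ge0_expectationZl ?invr_ge0 ?ler0n//; last 2 first.
- by apply: measurable_sum => j; exact: measurable_grad_sq.
- by move=> o; exact: sumr_ge0.
rewrite (@ge0_expectation_sum _ _ _ P _ _ (fun j o => grad_sq (S o) j t))//; last first.
  by move=> j; exact: measurable_grad_sq.
(* The factor [1] allows the constant sum to be factored as [n] times a possibly infinite value. *)
rewrite (eq_bigr (fun=> 1%:E * 'E_P[fun o => grad_sq (S o) i t])%E); last first.
  move=> j _; rewrite mul1e.
  rewrite -(expected_grad_sq_perm
    (tperm (widen_ord (leqnSn n) i) (widen_ord (leqnSn n) j)) i).
  congr expectation; apply/funext => o.
  have -> : (fun k => Zs (tperm (widen_ord (leqnSn n) i)
      (widen_ord (leqnSn n) j) (widen_ord (leqnSn n) k)) o) = S o \o tperm i j.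
    apply/funext => k /=; rewrite /S; congr (Zs _ o).
    by rewrite -(inj_tperm _ _ _ (@widen_ord_inj _ _ (leqnSn n))).
  by rewrite /grad_sq /gdW gd_iter_perm/= tpermL.
rewrite -ge0_sume_distrl// sumEFin sumr_const card_ord muleA -EFinM.
rewrite mulVf ?mul1e//.
by rewrite pnatr_eq0 -lt0n (leq_ltn_trans _ (ltn_ord i)).
Qed.

End expected_gradients.

(** * The two bounds in expectation *)

Theorem theorem10 (R : realType) (dO dZ : measure_display)
  (O : measurableType dO) (P : probability O R)
  (Z : measurableType dZ) (D : probability Z R)
  (d n : nat) (i : 'I_n)
  (* Zs j = z_{j+1} for j < n, and Zs ord_max = z_i' *)
  (Zs : 'I_n.+1 -> O -> Z)
  (f : 'rV[R]_d -> Z -> R) (gradf : 'rV[R]_d -> Z -> 'rV[R]_d)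
  (beta : R) (T : nat) (eta : nat -> R) (W1 : 'rV[R]_d)
  (Wstar : ('I_n -> Z) -> 'rV[R]_d) :
  iid_law P D Zs ->
  (forall w z, 0 <= f w z) ->
  (forall z, is_gradient (fun w => f w z) (fun w => gradf w z)) ->
  (forall z, convex_fun (fun w => f w z)) ->
  (forall z, smooth_grad (fun w => gradf w z) beta) ->
  (forall w, measurable_fun setT (f w)) ->
  (forall w (j : 'I_d), measurable_fun setT (fun z => gradf w z ord0 j)) ->
  (forall s w, emp_risk f s (Wstar s) <= emp_risk f s w) ->
  (forall j : 'I_d, measurable_fun setT
     (fun o => Wstar (fun k : 'I_n => Zs (widen_ord (leqnSn n) k) o) ord0 j)) ->
  (forall t, (1 <= t <= T.+1)%N -> 0 <= eta t <= (2 * beta)^-1) ->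
  let S := fun o => (fun k : 'I_n => Zs (widen_ord (leqnSn n) k) o) in
  let Si := fun o => replace_at (S o) i (Zs ord_max o) in
  let sumeta := \sum_(1 <= t < T.+1) eta t in
  let eps_stab := ('E_P[fun o => sqnorm (gdW gradf eta W1 (S o) T.+1
                                        - gdW gradf eta W1 (Si o) T.+1)])%E in
  let eps_path := (\sum_(1 <= t < T.+1)
        (eta t)%:E * 'E_P[fun o => sqnorm (gradf (gdW gradf eta W1 (S o) t) (S o i))])%E in
  let eps_c := ('E_P[fun o => emp_risk f (S o) (Wstar (S o))])%E in
  (eps_stab <= (4 * sumeta / (n%:R ^+ 2))%:E * eps_path)%E /\
  ((4 * sumeta / (n%:R ^+ 2))%:E * eps_path
     <= (32 * beta * sumeta / (n%:R ^+ 2))%:E *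
        ('E_P[fun o => sqnorm (W1 - Wstar (S o))] + eps_c * sumeta%:E))%E.
Proof.
move=> iidZ f0 gradE fconv fsmooth mf mgradf Wmin mWstar eta_b S Si sumeta
  eps_stab eps_path eps_c.
have mS k : measurable_fun setT (fun o => S o k) by exact: iidZ.1.
have mSi k : measurable_fun setT (fun o => Si o k).
  by rewrite /Si /replace_at; case: (k == i); exact: iidZ.1.
have eta_bT t : (1 <= t <= T)%N -> 0 <= eta t <= (2 * beta)^-1.
  by case/andP=> t1 tT; rewrite eta_b// t1 ltnW.
(* Time [1] lies in the range up to [T.+1] even for [T = 0], so the step-size bound always yields
   [0 <= beta]. *)
have [eta0 eta1] : 0 <= eta 1%N /\ eta 1%N <= (2 * beta)^-1.
  exact/andP/eta_b.
have : 0 <= beta.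
  by have := le_trans eta0 eta1; rewrite invr_ge0 pmulr_rge0.
(* If [beta = 0], then [(2 * beta)^-1] is [0] by convention: all steps vanish, both trajectories
   stay at [W1], and every term compared is [0]. *)
rewrite le_eqVlt => /predU1P[b0|beta0].
  have etaz t : (1 <= t <= T)%N -> eta t = 0.
    by move=> /eta_bT; rewrite -b0 mulr0 invr0 -eq_le => /eqP.
  have -> : sumeta = 0 by rewrite /sumeta big_nat big1.
  have -> : eps_stab = 0%E.
    rewrite /eps_stab [X in expectation _ X](_ : _ = cst 0).
      exact: expectation_cst.
    by apply/funext => o; rewrite /gdW/= !gd_iter_eta0// subrr sqnorm0.
  by rewrite !mulr0 !mul0r !mul0e.
have supf z : supporting (f^~ z) (gradf^~ z).
  exact: convex_gradient_supporting (fconv z) (gradE z).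
have cf z : continuous (f^~ z).
  by move=> w; apply: differentiable_continuous; exact: (gradE z w).1.
have b0 := ltW beta0.
have etage0 t : t \in index_iota 1 T.+1 -> 0 <= eta t.
  by rewrite mem_index_iota => /eta_bT/andP[].
have sumeta0 : 0 <= sumeta by rewrite /sumeta big_seq sumr_ge0.
pose A j t o := sqnorm (gradf (gdW gradf eta W1 (S o) t) (S o j)).
pose B t o := sqnorm (gradf (gdW gradf eta W1 (Si o) t) (Si o i)).
have A0 j t o : 0 <= A j t o by exact: sqnorm_ge0.
have B0 t o : 0 <= B t o by exact: sqnorm_ge0.
have mA j t : measurable_fun setT (A j t) by exact: (measurable_grad_sq _ _ b0).
have mB t : measurable_fun setT (B t) by exact: (measurable_grad_sq _ _ b0).
have weighted (F : nat -> O -> R) : (forall t, measurable_fun setT (F t)) ->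
    (forall t o, 0 <= F t o) ->
    ('E_P[fun o => (\sum_(1 <= t < T.+1) eta t * F t o)%R] =
     \sum_(1 <= t < T.+1) (eta t)%:E * 'E_P[F t])%E.
  move=> mF F0.
  rewrite (@ge0_expectation_sum _ _ _ P _ _ (fun t o => eta t * F t o)).
  - by apply: eq_big_seq => t /etage0 t0; rewrite ge0_expectationZl.
  - by move=> t; exact: measurable_funM.
  - by move=> t /etage0 t0 o; rewrite mulr_ge0.
have mW (F : nat -> O -> R) : (forall t, measurable_fun setT (F t)) ->
    measurable_fun setT (fun o => \sum_(1 <= t < T.+1) eta t * F t o).
  by move=> mF; apply: measurable_sum => t; exact: measurable_funM.
have W0 (F : nat -> O -> R) o : (forall t, 0 <= F t o) ->
    0 <= \sum_(1 <= t < T.+1) eta t * F t o.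
  move=> F0; rewrite big_seq sumr_ge0// => t /etage0 t0; exact: mulr_ge0.
have pathA : 'E_P[fun o => (\sum_(1 <= t < T.+1) eta t * A i t o)%R]%E = eps_path.
  exact: weighted.
(* The perturbed trajectory contributes the same path error, so the [2] of [gd_stability_sq] becomes
   the [4] of the first bound. *)
have pathB : 'E_P[fun o => (\sum_(1 <= t < T.+1) eta t * B t o)%R]%E = eps_path.
  rewrite weighted//; apply: eq_bigr => t _; congr (_ * _)%E.
  exact: (expected_grad_sq_replace _ _ iidZ b0 fsmooth mgradf).
have path0 : (0 <= eps_path)%E.
  by rewrite -pathA expectation_ge0// => o; exact: W0.
have c0 : 0 <= sumeta / n%:R ^+ 2 by rewrite divr_ge0 ?exprn_ge0 ?ler0n.
split.
  apply: (@le_trans _ _ 'E_P[fun o => (2 * sumeta / n%:R ^+ 2 *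
      (\sum_(1 <= t < T.+1) eta t * A i t o +
       \sum_(1 <= t < T.+1) eta t * B t o))%R]%E).
    apply: ge0_expectation_le => [||o].
    - apply: measurable_sqnorm => j.
      rewrite (_ : (fun o => _) = (fun o => gdW gradf eta W1 (S o) T.+1 ord0 j -
          gdW gradf eta W1 (Si o) T.+1 ord0 j)); last first.
        by apply/funext => o; rewrite !mxE.
      by apply: measurable_funB; exact: (measurable_gd b0).
    - by apply: measurable_funM => //; apply: measurable_funD; exact: mW.
    - rewrite sqnorm_ge0/= -big_split/=; under eq_bigr do rewrite -mulrDr.
      apply: (gd_stability_sq _ beta0 supf) => // j ji.
      by rewrite /Si /replace_at (negbTE ji).
  rewrite ge0_expectationZl.
  - rewrite ge0_expectationD ?pathA ?pathB//; try exact: mW.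
    + rewrite ge0_muleDr// -ge0_muleDl ?lee_fin -?mulrA ?mulr_ge0//.
      by rewrite -EFinD -mulrDl (_ : 2 + 2 = 4 :> R)//; ring.
    + by move=> o; exact: W0.
    + by move=> o; exact: W0.
  - by apply: measurable_funD; exact: mW.
  - by move=> o; rewrite addr_ge0 ?W0.
  - by rewrite -mulrA mulr_ge0.
have risk0 w o : 0 <= emp_risk f (S o) w.
  by rewrite mulr_ge0 ?invr_ge0 ?ler0n// sumr_ge0.
have mdist : measurable_fun setT (fun o => sqnorm (W1 - Wstar (S o))).
  apply: measurable_sqnorm => j.
  rewrite (_ : (fun o => _) = (fun o => W1 ord0 j - Wstar (S o) ord0 j)).
    exact: measurable_funB.
  by apply/funext => o; rewrite !mxE.
have mrisk : measurable_fun setT (fun o => emp_risk f (S o) (Wstar (S o))).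
  exact: measurable_emp_risk.
have path_le : (eps_path <= (8 * beta)%:E *
    ('E_P[fun o => sqnorm (W1 - Wstar (S o))] + eps_c * sumeta%:E))%E.
  (* Averaging over the examples brings the sum inside [emp_risk] into play, so the rest of the
     estimate holds pointwise in [o]. *)
  have -> : eps_path = ('E_P[fun o => (\sum_(1 <= t < T.+1)
      eta t * (n%:R^-1 * \sum_(j < n) A j t o))%R])%E.
    rewrite (weighted (fun t o => n%:R^-1 * \sum_(j < n) A j t o)).
    - apply: eq_bigr => t _; congr (_ * _)%E; apply/esym.
      exact: (expected_grad_sq_avg _ _ iidZ b0 fsmooth mgradf).
    - by move=> t; apply: measurable_funM => //; exact: measurable_sum.
    - by move=> t o; rewrite mulr_ge0 ?invr_ge0 ?ler0n// sumr_ge0.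
  rewrite [(eps_c * _)%E]muleC -ge0_expectationZl//.
  rewrite -ge0_expectationD//; last 3 first.
  - exact: measurable_funM.
  - by move=> o; exact: sqnorm_ge0.
  - by move=> o; exact: mulr_ge0.
  rewrite -ge0_expectationZl; last 3 first.
  - by apply: measurable_funD => //; exact: measurable_funM.
  - by move=> o; rewrite addr_ge0 ?sqnorm_ge0// mulr_ge0.
  - by rewrite mulr_ge0.
  apply: ge0_expectation_le => [||o].
  - apply: mW => t; apply: measurable_funM => //; exact: measurable_sum.
  - apply: measurable_funM => //; apply: measurable_funD => //.
    exact: measurable_funM.
  rewrite (W0 (fun t o => n%:R^-1 * \sum_(j < n) A j t o))/=; last first.
    by move=> t; rewrite mulr_ge0 ?invr_ge0 ?ler0n// sumr_ge0.
  have := gd_regret W1 beta0 supf fsmooth eta_bT (Wmin (S o)).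
  rewrite (_ : \sum_(1 <= t < T.+1) _ = \sum_(1 <= t < T.+1)
      eta t * emp_risk f (S o) (gdW gradf eta W1 (S o) t) -
      sumeta * emp_risk f (S o) (Wstar (S o))) => [regret|]; last first.
    by rewrite /sumeta mulr_suml -sumrB; apply: eq_bigr => t _; rewrite mulrBr.
  (* Each squared gradient is at most [4 * beta] times the loss, by the self-bounding inequality
     with [m = 0]. *)
  apply: (@le_trans _ _ (4 * beta * \sum_(1 <= t < T.+1)
      eta t * emp_risk f (S o) (gdW gradf eta W1 (S o) t))).
    rewrite mulr_sumr big_seq [leRHS]big_seq ler_sum// => t /etage0 t0.
    rewrite [leRHS]mulrCA ler_wpM2l// /emp_risk [leRHS]mulrCA.
    rewrite ler_wpM2l ?invr_ge0 ?ler0n// mulr_sumr.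
    apply: ler_sum => j _.
    have := sqnorm_gradient_le beta0 (supf (S o j)) (fsmooth (S o j))
      (gdW gradf eta W1 (S o) t) (fun w => f0 w (S o j)).
    by rewrite subr0.
  have r0 := mulr_ge0 sumeta0 (risk0 (Wstar (S o)) o).
  have d0 := sqnorm_ge0 (W1 - Wstar (S o)).
  (* The regret bound gives half the squared distance plus [sumeta] times the minimal risk; doubling
     this is slack. The resulting [8] times the earlier [4] is the final [32]. *)
  rewrite (_ : 8 * beta = 4 * beta * 2); last by ring.
  rewrite -[leRHS]mulrA ler_wpM2l ?mulr_ge0//; lra.
apply: le_trans (lee_wpmul2l _ path_le) _.
  by rewrite lee_fin -mulrA mulr_ge0.
rewrite muleA -EFinM.
by rewrite (_ : 4 * sumeta / n%:R ^+ 2 * (8 * beta) = 32 * beta * sumeta / n%:R ^+ 2)//; ring.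
Qed.
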